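(* The minimum size $f(d)$ of a double cover of $\{0,1,2\}^d$ satisfies $$f(4)\ge 19,\quad f(5)\ge 33,\quad f(6)\ge 57,\quad f(7)\ge 97,\quad f(8)\ge 164.$$
   Context: Write $[3]=\{0,1,2\}$. A proper sub-box of $[3]^d$ is a set $B=S_1\times\dots\times S_d$ with $\varnothing\neq S_i\subsetneq[3]$ for every $1\le i\le d$ (so each side $S_i$ has one or two elements). A double cover of $[3]^d$ is a finite multiset $\{B_1,\dots,B_m\}$ of proper sub-boxes such that every point of $[3]^d$ lies in exactly two of the $B_j$, counted with multiplicity; its size is $m$. $f(d)$ denotes the minimum size of a double cover of $[3]^d$. The base value $f(3)=11$ is taken as known (it is established by exhaustive computation). *)

(* Defs.v *)
From mathcomp Require Import all_boot.

Set Implicit Arguments.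
Unset Strict Implicit.
Unset Printing Implicit Defensive.

Definition point (d : nat) := {ffun 'I_d -> 'I_3}.

Definition cartesian (d : nat) (S : {ffun 'I_d -> {set 'I_3}}) : {set point d} :=
  [set x : point d | [forall i, x i \in S i]].

Definition proper_subbox (d : nat) (B : {set point d}) : bool :=
  [exists S : {ffun 'I_d -> {set 'I_3}},
    [forall i, (S i != set0) && (S i \proper [set: 'I_3])]
    && (B == cartesian S)].

(* Multisets of boxes are represented by sequences: the predicate is invariant
   under permutation, and [count] takes repetitions into account. *)
Definition double_cover (d : nat) (s : seq {set point d}) : bool :=
  all (@proper_subbox d) s
  && [forall x : point d, count (fun B : {set point d} => x \in B) s == 2].

Definition has_double_cover (d m : nat) : bool :=
  [exists s : m.-tuple {set point d}, double_cover s].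

(* All singletons, each taken twice. *)
Lemma has_double_cover_exists (d : nat) : exists m, has_double_cover d m.
Proof.
pose e := [seq [set x] | x <- enum {: point d}].
exists (size (e ++ e)); apply/existsP; exists (in_tuple (e ++ e)).
rewrite /double_cover /= all_cat andbb; apply/andP; split.
  apply/allP => _ /mapP[x _ ->]; apply/existsP.
  exists [ffun i => [set x i]]; apply/andP; split.
    apply/forallP => i; rewrite ffunE; apply/andP; split.
      by apply/set0Pn; exists (x i); rewrite set11.
    by rewrite properEcard subsetT cards1 cardsT card_ord.
  apply/eqP/setP => y; rewrite !inE; apply/eqP/forallP => [-> i|yx].
    by rewrite ffunE set11.
  by apply/ffunP => i; move: (yx i); rewrite ffunE inE => /eqP.
apply/forallP => x; rewrite count_cat count_map.
rewrite (eq_count (a2 := pred1 x)); last by move=> y; rewrite /= inE eq_sym.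
by rewrite count_uniq_mem ?enum_uniq // mem_enum.
Qed.

Definition f (d : nat) : nat := ex_minn (has_double_cover_exists d).

(* Main.v *)
(* Let c(B) be the number of two-element sides of B.  Restricting a double cover
   of size m to the three hyperplanes x_i = a gives sum_B |B_i| >= 3 f(d-1) for
   every direction i, hence a lower bound on sum_B c(B).  On the other hand
   sum_B 2 ^ c(B) = 2 * 3 ^ d, and by convexity of 2 ^ c this caps sum_B c(B).
   The two bounds together give f(3) >= 11 and, except for d = 2 and d = 6, all
   the values needed; a parity argument gains the missing 1 in those two cases. *)
Require Import Defs.
From mathcomp Require Import all_boot.
From mathcomp Require Import zify.

Set Implicit Arguments.
Unset Strict Implicit.
Unset Printing Implicit Defensive.

(** * Boxes given by their sides *)

Notation sides d := {ffun 'I_d -> {set 'I_3}}.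

Definition proper_sides d (S : sides d) := forall i, 0 < #|S i| < 3.

(** Membership is a product of 0/1 factors, so that sums over points factor coordinatewise. *)
Definition sides_cover d (t : seq (sides d)) :=
  {in t, forall S, proper_sides S} /\
  forall x : point d, \sum_(S <- t) \prod_i (x i \in S i) = 2.

Definition cover_bound d N := forall t : seq (sides d), sides_cover t -> N <= size t.

Lemma in_cartesian d (S : sides d) (x : point d) :
  (x \in cartesian S) = \prod_i (x i \in S i) :> nat.
Proof.
rewrite inE; case: forallP => [xS|/forallP]; last first.
  by rewrite negb_forall => /existsP[i /negbTE xi]; rewrite (bigD1 i) //= xi.
by rewrite big1 // => i _; rewrite xS.
Qed.

Lemma double_cover_sides d (s : seq {set point d}) :
  double_cover s -> exists2 t : seq (sides d), size t = size s & sides_cover t.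
Proof.
case/andP=> s_box /forallP s2.
have [t tP def_s]: exists2 t : seq (sides d), {in t, forall S, proper_sides S} &
    s = map (@cartesian d) t.
  elim: s s_box {s2} => [|B s IHs] /=; first by exists [::].
  case/andP=> /existsP[S /andP[/forallP SP /eqP->]] /IHs[t tP ->].
  exists (S :: t) => // T; rewrite inE => /predU1P[-> i|/tP//].
  have /andP[S0 /proper_card] := SP i.
  by rewrite card_gt0 S0 cardsT card_ord.
exists t; first by rewrite def_s size_map.
split=> // x; have /eqP e := s2 x.
rewrite -[RHS]e def_s count_map -sum1_count [RHS]big_mkcond /=.
by apply: eq_bigr => S _; rewrite -in_cartesian; case: (_ \in _).
Qed.

Lemma cover_bound_f d N : cover_bound d N -> N <= f d.
Proof.
move=> dN; rewrite /f; case: ex_minnP => m /existsP[s /double_cover_sides[t]].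
by rewrite size_tuple => <- /dN.
Qed.

(** * Volume and slices *)

Lemma cover_volume d (t : seq (sides d)) :
  sides_cover t -> \sum_(S <- t) \prod_i #|S i| = 2 * 3 ^ d.
Proof.
case=> _ t2; transitivity (\sum_(x : point d) 2).
  under [RHS]eq_bigr => x _ do rewrite -(t2 x).
  rewrite exchange_big; apply: eq_bigr => S _.
  rewrite -(bigA_distr_bigA (fun i a => nat_of_bool (a \in S i))).
  by apply: eq_bigr => i _; rewrite -sum1_card big_mkcond.
by rewrite sum_nat_const card_ffun !card_ord mulnC.
Qed.

Definition slice d (i : 'I_d.+1) (a : 'I_3) (t : seq (sides d.+1)) : seq (sides d) :=
  [seq [ffun j => B (lift i j)] | B : sides d.+1 <- t & a \in (B : sides d.+1) i].

Lemma slice_cover d i a (t : seq (sides d.+1)) :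
  sides_cover t -> sides_cover (slice i a t).
Proof.
case=> tP t2; split=> [_ /mapP[S + ->] j|x].
  by rewrite mem_filter => /andP[_ St]; rewrite ffunE; apply: tP.
pose y : point d.+1 := [ffun k => if unlift i k is Some j then x j else a].
rewrite -[RHS](t2 y) big_map big_filter big_mkcond /=; apply: eq_bigr => S _.
rewrite (bigD1_ord i) //= ffunE unlift_none; case: (a \in S i); last by rewrite mul0n.
by rewrite mul1n; apply: eq_bigr => j _; rewrite !ffunE liftK.
Qed.

(** A box [S] meets exactly [#|S i|] of the three hyperplanes orthogonal to direction [i]. *)
Lemma sum_size_slice d i (t : seq (sides d.+1)) :
  \sum_a size (slice i a t) = \sum_(S <- t) #|S i|.
Proof.
under eq_bigr => a _ do rewrite size_map size_filter -sum1_count big_mkcond.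
rewrite exchange_big; apply: eq_bigr => S _.
by rewrite -sum1_card [RHS]big_mkcond.
Qed.

Lemma sum_side_ge d N i (t : seq (sides d.+1)) :
  cover_bound d N -> sides_cover t -> 3 * N <= \sum_(S <- t) #|S i|.
Proof.
move=> dN tC; rewrite -(sum_size_slice i).
rewrite -[X in X * _](card_ord 3) -sum_nat_const; apply: leq_sum => a _.
exact/dN/slice_cover.
Qed.

Definition pairs d (S : sides d) := \sum_i (#|S i| == 2).

Lemma prod_side d (S : sides d) : proper_sides S -> \prod_i #|S i| = 2 ^ pairs S.
Proof.
move=> SP; rewrite /pairs expn_sum; apply: eq_bigr => i _.
by case: #|S i| (SP i) => [|[|[]]].
Qed.

Lemma sum_side d (S : sides d) : proper_sides S -> \sum_i #|S i| = d + pairs S.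
Proof.
move=> SP; rewrite -[X in X + _]card_ord -sum1_card -big_split.
by apply: eq_bigr => i _; case: #|S i| (SP i) => [|[|[]]].
Qed.

Lemma cover_pow d (t : seq (sides d)) :
  sides_cover t -> \sum_(S <- t) 2 ^ pairs S = 2 * 3 ^ d.
Proof.
move=> tC; rewrite -(cover_volume tC) big_seq [RHS]big_seq.
by apply: eq_bigr => S /tC.1/prod_side.
Qed.

Lemma sum_pairs_ge d N (t : seq (sides d.+1)) :
  cover_bound d N -> sides_cover t ->
  d.+1 * (3 * N) <= d.+1 * size t + \sum_(S <- t) pairs S.
Proof.
move=> dN tC; have -> : d.+1 * size t = \sum_(S <- t) d.+1.
  by rewrite big_const_seq iter_addn_0 count_predT.
rewrite -big_split big_seq /=.
under [X in _ <= X]eq_bigr => S St do rewrite -(sum_side (tC.1 S St)).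
rewrite -big_seq exchange_big -[X in X * _]card_ord -sum_nat_const.
by apply: leq_sum => i _; apply: sum_side_ge.
Qed.

(** * The recursive bound from convexity *)

(* Convexity: 2 ^ j * (c + 1 - j) is the chord of 2 ^ c through c = j and
   c = j + 1. *)
Lemma pow2_chord j c : 2 ^ j * c.+1 <= 2 ^ c + j * 2 ^ j.
Proof.
have [lt_cj|le_jc] := ltnP c j.
  by rewrite mulnC (leq_trans (leq_mul lt_cj (leqnn _))) ?leq_addl.
rewrite -(subnK le_jc) expnD.
have := ltn_expl (c - j) (isT : 1 < 2); nia.
Qed.

Lemma sum_chord j d (t : seq (sides d)) :
  2 ^ j * (\sum_(S <- t) pairs S + size t) <=
    \sum_(S <- t) 2 ^ pairs S + size t * (j * 2 ^ j).
Proof.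
elim: t => [|S t IHt]; first by rewrite !big_nil muln0.
by rewrite !big_cons /=; have := pow2_chord j (pairs S); nia.
Qed.

(** Eliminates the total number of pairs between its lower and upper bounds. The parameter [j] is
    free; the best choice is near the average number of pairs per box. *)
Lemma cover_bound_chord j d N (t : seq (sides d.+1)) :
  cover_bound d N -> sides_cover t ->
  2 ^ j * (d.+1 * (3 * N) + size t) <=
    2 * 3 ^ d.+1 + size t * (2 ^ j * (d.+1 + j)).
Proof.
move=> dN tC; have := sum_pairs_ge dN tC; have := sum_chord j t.
rewrite (cover_pow tC); nia.
Qed.

(** * Dimensions 0 to 2 *)

Lemma cover_bound0 : cover_bound 0 2.
Proof.
move=> t [_ /(_ [ffun=> ord0])].
under eq_bigr => S _ do rewrite big_ord0.
by rewrite sum1_size => ->.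
Qed.

Lemma cover_bound1 : cover_bound 1 3.
Proof. by move=> t /(cover_bound_chord 1 cover_bound0); lia. Qed.

Lemma cover_volume2 (i : 'I_2) (t : seq (sides 2)) :
  sides_cover t -> \sum_(S <- t) #|S i| * #|S (lift i ord0)| = 18.
Proof.
move=> tC; rewrite -[RHS](cover_volume tC); apply: eq_bigr => S _.
by rewrite (bigD1_ord i) //= big_ord1.
Qed.

Lemma slice_volume2 (i : 'I_2) a (t : seq (sides 2)) :
  sides_cover t -> \sum_(S <- t) (a \in S i) * #|S (lift i ord0)| = 6.
Proof.
move/(slice_cover i a)/cover_volume => vol.
rewrite -[RHS]vol big_map big_filter [RHS]big_mkcond /=.
by apply: eq_bigr => S _; rewrite big_ord1 ffunE; case: (a \in S i); rewrite ?mul1n.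
Qed.

(* If no box is a singleton in direction i, then for each a the boxes avoiding
   x i = a partition the line: one of them is a singleton in the other
   direction, as 3 is odd. *)
Lemma cover2_side_le (i : 'I_2) (t : seq (sides 2)) :
  sides_cover t -> size t = 5 -> \sum_(S <- t) #|S i| <= 9.
Proof.
set j := lift i ord0 => tC szt; rewrite leqNgt; apply/negP=> gtA.
have sum_cst c : \sum_(S <- t) c = 5 * c.
  by rewrite big_const_seq iter_addn_0 count_predT szt mulnC.
have le_t (F G : sides 2 -> nat) :
    (forall S : sides 2, 0 < #|S i| < 3 -> 0 < #|S j| < 3 -> F S <= G S) ->
    \sum_(S <- t) F S <= \sum_(S <- t) G S.
  move=> leFG; rewrite big_seq [X in _ <= X]big_seq.
  by apply: leq_sum => S /tC.1 SP; apply: leFG.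
have T9 : \sum_(S <- t) #|S j| <= 9.
  (* Termwise this is (2 - a)(2 - b) >= 0; the right side sums to 18 + 20. *)
  have : \sum_(S <- t) (2 * #|S j| + 2 * #|S i|) <=
         \sum_(S <- t) (#|S i| * #|S j| + 4).
    by apply: le_t => S; nia.
  rewrite !big_split /= (cover_volume2 i tC) !sum_cst; move: gtA.
  set A := \sum_(S <- t) #|S i|; set T := \sum_(S <- t) #|S j|; lia.
have geT : 9 <= \sum_(S <- t) #|S j| := sum_side_ge j cover_bound1 tC.
have odd_a a : 1 <= \sum_(S <- t) (a \notin S i) * (#|S j| == 1).
  (* The left side is even, as the slice at [a] has volume 6, while the [#|S j|] sum to 9: the
     remaining sum is odd. *)
  have : \sum_(S <- t) ((a \in S i) * #|S j| + 2 * (a \notin S i)) =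
         \sum_(S <- t) (#|S j| + (a \notin S i) * (#|S j| == 1)).
    rewrite big_seq [RHS]big_seq; apply: eq_bigr => S /tC.1/(_ j).
    by case: (a \in S i); case: #|S j| => [|[|[]]].
  rewrite !big_split /= (slice_volume2 i a tC) !sum_cst; move: T9 geT.
  set T := \sum_(S <- t) #|S j|; set V := \sum_(S <- t) _ * (_ == 1); lia.
have : \sum_(a : 'I_3) 1 <=
       \sum_(a : 'I_3) \sum_(S <- t) (a \notin S i) * (#|S j| == 1).
  by apply: leq_sum => a _; apply: odd_a.
rewrite sum1_card card_ord exchange_big /=.
(* If [#|S j|] is 1, the term is (3 - [#|S i|]) + 1 + [#|S i|] = 4. The totals would give 3 + 9 + 10
   <= 20. *)
have : \sum_(S <- t) ((\sum_a (a \notin S i) * (#|S j| == 1)) + (#|S j| + #|S i|)) <=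
       \sum_(S <- t) 4.
  apply: le_t => S.
  have -> : \sum_a (a \notin S i) * (#|S j| == 1) =
            (\sum_a (a \notin S i)) * (#|S j| == 1) by rewrite big_distrl.
  have : \sum_a (a \notin S i) + #|S i| = 3.
    rewrite -sum1_card [X in _ + X]big_mkcond -big_split /=.
    rewrite -[RHS](card_ord 3) -sum1_card.
    by apply: eq_bigr => a _; case: (a \in S i).
  by case: #|S j| => [|[|[]]] //=; lia.
rewrite !big_split /= sum_cst; move: gtA geT.
set A := \sum_(S <- t) #|S i|; set T := \sum_(S <- t) #|S j|.
set V := \sum_(S <- t) \sum_a _; lia.
Qed.

Lemma cover_bound2 : cover_bound 2 6.
Proof.
move=> t tC; rewrite leqNgt; apply/negP => lt_t6.
have szt : size t = 5.
  by have := cover_bound_chord 1 cover_bound1 tC; lia.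
have le0 := cover2_side_le ord0 tC szt.
have le1 := cover2_side_le (lift ord0 ord0) tC szt.
have vol := cover_volume2 ord0 tC.
(* Termwise this is (2 - a)(b - 1) >= 0; as both side sums are at most 9, it would give 18 + 10 <= 9
   + 18. *)
suff : \sum_(S <- t) #|S ord0| * #|S (lift ord0 ord0)| + \sum_(S <- t) 2 <=
       \sum_(S <- t) #|S ord0| + \sum_(S <- t) 2 * #|S (lift ord0 ord0)|.
  rewrite big_const_seq iter_addn_0 count_predT szt -big_distrr /=.
  move: le0 le1; rewrite /= vol.
  by set A := \sum_(S <- t) _; set B := \sum_(S <- t) _; lia.
rewrite -!big_split big_seq [X in _ <= X]big_seq; apply: leq_sum => S /tC.1 SP /=.
have := SP ord0; have := SP (lift ord0 ord0).
by case: #|S ord0| => [|[|[]]] //; case: #|S (lift ord0 ord0)| => [|[|[]]].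
Qed.

(** * Dimensions 3 to 8 *)

Lemma cover_bound3 : cover_bound 3 11.
Proof. by move=> t /(cover_bound_chord 2 cover_bound2); lia. Qed.

Lemma cover_bound4 : cover_bound 4 19.
Proof. by move=> t /(cover_bound_chord 3 cover_bound3); lia. Qed.

Lemma cover_bound5 : cover_bound 5 33.
Proof. by move=> t /(cover_bound_chord 3 cover_bound4); lia. Qed.

(* The chord inequality leaves room for 56 boxes; but 4 does not divide
   2 * 3 ^ 6, so some box has at most one pair, far from the chord. *)
Lemma cover_bound6 : cover_bound 6 57.
Proof.
move=> t tC; have [S St le1] : exists2 S, S \in t & pairs S <= 1.
  apply/hasP; apply: contraT => /hasPn t2.
  suff: 4 %| \sum_(S <- t) 2 ^ pairs S by rewrite (cover_pow tC).
  rewrite big_seq; apply: dvdn_sum => S /t2; rewrite -ltnNge => lt1.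
  by rewrite (dvdn_exp2l 2 lt1).
(* [S] is counted exactly, outside the chord sum: with 56 boxes the total slack is at most 18, but
   [S] alone lies at least 34 above its chord. *)
have := sum_pairs_ge cover_bound5 tC; have := sum_chord 4 (rem S t).
have := cover_pow tC; have := perm_to_rem St => pt.
rewrite !(perm_big _ pt) (perm_size pt) !big_cons /=.
by case: (pairs S) le1 => [|[]] //; lia.
Qed.

Lemma cover_bound7 : cover_bound 7 97.
Proof. by move=> t /(cover_bound_chord 5 cover_bound6); lia. Qed.

Lemma cover_bound8 : cover_bound 8 164.
Proof. by move=> t /(cover_bound_chord 6 cover_bound7); lia. Qed.

Theorem theorem4p3 :
  [/\ 19 <= f 4, 33 <= f 5, 57 <= f 6, 97 <= f 7 & 164 <= f 8].
Proof.
split; apply: cover_bound_f.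
- exact: cover_bound4.
- exact: cover_bound5.
- exact: cover_bound6.
- exact: cover_bound7.
- exact: cover_bound8.
Qed.
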